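(* Let $n,k\ge4$. Let $F(a_i,b_i)$ be a closed 2-frieze pattern of period $2n$ and $F(a'_i,b'_i)$ a closed 2-frieze pattern of period $2k$. Then any connected sum of $F(a_i,b_i)$ and $F(a'_i,b'_i)$ is a closed 2-frieze pattern of period $2(n+k-3)$. If moreover $F(a_i,b_i)$ and $F(a'_i,b'_i)$ are arithmetic, then their connected sum is also a closed arithmetic 2-frieze pattern.
   Context: Indices $(p,q)$ of a 2-frieze range over pairs in $\mathbb Z^2\cup(\mathbb Z+\tfrac12)^2$ with $p-q\ge -3$; the entries with $p-q=r$ form row $r$. A 2-frieze pattern satisfies the rule $$v_{p,q}=v_{p-\frac12,q-\frac12}\,v_{p+\frac12,q+\frac12}-v_{p-\frac12,q+\frac12}\,v_{p+\frac12,q-\frac12}$$ for all $(p,q)$ with $p-q\ge -2$. The algebraic 2-frieze $F(A_i,B_i)$, with $A_i,B_i$ ($i\in\mathbb Z$) independent formal variables, is the 2-frieze in which rows $-3$ and $-2$ consist of $0$'s, row $-1$ consists of $1$'s, $v_{i,i}=A_i$ and $v_{i-\frac12,i-\frac12}=B_i$ (row $0$, so that row $0$ reads $\dots,B_i,A_i,B_{i+1},A_{i+1},\dots$), and the rows $r\ge1$ are determined by the rule in the field of rational functions; all its entries are polynomials in the $A_i,B_i$. The numerical 2-frieze $F(a_i,b_i)$ is the evaluation at $A_i=a_i$, $B_i=b_i$. $F(a_i,b_i)$ is a closed 2-frieze of period $2n$ if it is closed of width $n-4$, i.e. row $n-4$ consists of $1$'s and rows $n-3,n-2$ consist of $0$'s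 (then $a_{i+n}=a_i$, $b_{i+n}=b_i$). A closed 2-frieze is arithmetic if its entries in rows $0,\dots,n-4$ are positive integers. Connected sum: let row $0$ of the first frieze have period $b_1,a_1,b_2,a_2,\dots,b_n,a_n$ and row $0$ of the second have period $b'_1,a'_1,b'_2,a'_2,\dots,b'_k,a'_k$. Cut the first sequence at an arbitrary place; insert there the $2(k-3)$ numbers $a'_2,b'_3,a'_3,\dots,a'_{k-2},b'_{k-1}$; and modify the three left and three right neighbours of the inserted block. If the cut is between $b_2$ and $a_2$, the modification is $$(b_1,a_1,b_2)\to(b_1+b'_1,\;a_1+a'_1+b_2b'_1,\;b_2+b'_2),\qquad (a_2,b_3,a_3)\to(a_2+a'_{k-1},\;b_3+b'_k+a_2a'_k,\;a_3+a'_k),$$ and the other $2(n-3)$ entries are unchanged. In general, writing $c_{2i-1}=b_i$, $c_{2i}=a_i$ ($2n$-periodic in the index) and cutting between $c_s$ and $c_{s+1}$, the new $2(n+k-3)$-periodic sequence is $$c_{s-2}+b'_1,\;\;c_{s-1}+a'_1+c_sb'_1,\;\;c_s+b'_2,\;\;a'_2,b'_3,\dots,a'_{k-2},b'_{k-1},\;\;c_{s+1}+a'_{k-1},\;\;c_{s+2}+b'_k+c_{s+1}a'_k,\;\;c_{s+3}+a'_k,\;\;c_{s+4},\dots,c_{s+2n-3}.$$ The connected sum is the 2-frieze whose row $0$ is this sequence, taken (in order) as the values $b_1,a_1,b_2,a_2,\dots$ of the new pattern and extended periodically. *)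

(* Defs.v *)
From HB Require Import structures.
From mathcomp Require Import all_boot all_order all_algebra.
From mathcomp Require Import finmap ring.
From mathcomp.multinomials Require Import monalg.

Set Implicit Arguments.
Unset Strict Implicit.
Unset Printing Implicit Defensive.

Import Order.TTheory GRing.Theory Num.Theory.
Local Open Scope ring_scope.

(* inl i stands for A_i and inr i for B_i. *)
Definition frieze_var : Type := (int + int)%type.
HB.instance Definition _ := Countable.on frieze_var.

(* The ring Z[A_i, B_i : i in Z] in infinitely many variables, evaluated in any
   commutative ring by frieze_eval. *)
Definition frieze_poly : Type := {malg int[{cmonom frieze_var}]}.
HB.instance Definition _ := GRing.ComNzRing.on frieze_poly.

Definition fvar (x : frieze_var) : frieze_poly := << ucm x >>.

Section Evaluation.
Context (S : comNzRingType) (h : frieze_var -> S).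

Definition monom_eval (m : {cmonom frieze_var}) : S :=
  \prod_(i <- finsupp m) h i ^+ m i.

Lemma monom_evalEw (m : {cmonom frieze_var}) (d : {fset frieze_var}) :
  (finsupp m `<=` d)%fset -> monom_eval m = \prod_(i <- d) h i ^+ m i.
Proof.
move=> le; rewrite /monom_eval (big_fset_incl _ le) //= => i _.
by rewrite -cmE_eq0 => /eqP ->; rewrite expr0.
Qed.

Lemma monom_eval_mmorphism : mmorphism monom_eval.
Proof.
split=> [m1 m2|]; last by rewrite /monom_eval mdom1 big_seq_fset0.
rewrite {1}/monom_eval mdomD.
rewrite (monom_evalEw (fsubsetUl _ (finsupp m2))).
rewrite (monom_evalEw (fsubsetUr (finsupp m1) _)).
by rewrite -big_split /=; apply: eq_bigr => i _; rewrite cmM exprD.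
Qed.

HB.instance Definition _ := isMultiplicative.Build _ _ monom_eval
  monom_eval_mmorphism.

End Evaluation.

HB.lock Definition frieze_eval (S : comNzRingType) (h : frieze_var -> S)
  (p : frieze_poly) : S := mmap (intr : int -> S) (monom_eval h) p.
Canonical frieze_eval_unlockable := Unlockable frieze_eval.unlock.

Section EvaluationTheory.
Context (S : comNzRingType) (h : frieze_var -> S).

Lemma frieze_eval_zmod_morphism : zmod_morphism (frieze_eval h).
Proof. by move=> p q; rewrite unlock; exact: raddfB. Qed.
HB.instance Definition _ := GRing.isZmodMorphism.Build frieze_poly S (frieze_eval h)
  frieze_eval_zmod_morphism.

Lemma frieze_eval_monoid_morphism : monoid_morphism (frieze_eval h).
Proof. by split=> [|p q]; rewrite unlock; [exact: mmap1|exact: rmorphM]. Qed.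
HB.instance Definition _ := GRing.isMonoidMorphism.Build frieze_poly S (frieze_eval h)
  frieze_eval_monoid_morphism.

Lemma frieze_evalX x : frieze_eval h (fvar x) = h x.
Proof.
by rewrite unlock mmapU mul1r /monom_eval mdomU big_seq_fset1 cmUU expr1.
Qed.

End EvaluationTheory.

(* frieze_poly is an integral domain: substituting 'X ^+ (N ^ k x) for each
   variable x, where k is an injection into nat, is injective on a given finite
   set of monomials for a suitable N. *)

Definition kronecker (N : nat) (x : frieze_var) : {poly int} := 'X^(N ^ choice.pickle x).

Definition weight_poly (m : {cmonom frieze_var}) : {poly int} :=
  \sum_(x <- finsupp m) (m x)%:R *: 'X^(choice.pickle x).

Lemma weight_poly_inj : injective weight_poly.
Proof.
move=> m1 m2 /polyP eq12; apply/eqP/cmP => x.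
have coefW m : (weight_poly m)`_(choice.pickle x) = (m x)%:R.
  rewrite coef_sum (eq_bigr (fun y => (m y * (y == x))%:R)) => [|y _]; last first.
    by rewrite coefZ coefXn (inj_eq (pcan_inj choice.pickleK)) [y == x]eq_sym natrM.
  case: (mdomP m x) => [xm|xNm].
    rewrite (big_fsetD1 x) //= eqxx muln1 big1_seq ?addr0 // => y.
    by rewrite !inE => /andP[_ /andP[/negPf ->]]; rewrite muln0.
  rewrite big1_seq // => y /andP[_ ym]; case: eqP => [e|_]; rewrite ?muln0 //.
  by rewrite e (negPf xNm) in ym.
have := eq12 (choice.pickle x); rewrite !coefW => /eqP.
by rewrite eqr_nat => /eqP.
Qed.

Definition weight (N : nat) (m : {cmonom frieze_var}) : nat :=
  (\sum_(x <- finsupp m) m x * N ^ choice.pickle x)%N.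

Lemma monom_eval_kronecker N m : monom_eval (kronecker N) m = 'X^(weight N m).
Proof.
rewrite /monom_eval /weight.
elim: (enum_fset (finsupp m)) => [|x s IHs]; first by rewrite !big_nil expr0.
by rewrite !big_cons IHs exprD /kronecker -exprM mulnC.
Qed.

Lemma horner_weight_poly N m : (weight_poly m).[N%:R] = (weight N m)%:R.
Proof.
rewrite horner_sum natr_sum; apply: eq_bigr => x _.
by rewrite hornerZ hornerXn natrM natrX.
Qed.

Definition separator (p : frieze_poly) : {poly int} :=
  \prod_(m <- msupp p) \prod_(m' <- msupp p | m' != m)
    (weight_poly m' - weight_poly m).

Lemma separator_neq0 p : separator p != 0.
Proof.
rewrite /separator prodf_seq_neq0; apply/allP => m _ /=.
rewrite prodf_seq_neq0; apply/allP => m' _; apply/implyP => ne.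
by rewrite subr_eq0 (inj_eq weight_poly_inj).
Qed.

Lemma frieze_eval_kronecker N (p : frieze_poly) :
  frieze_eval (kronecker N) p = \sum_(m <- msupp p) mcoeff m p *: 'X^(weight N m).
Proof.
rewrite unlock mmapE; apply: eq_bigr => m _.
by rewrite monom_eval_kronecker -scaler_int -scalerAl mul1r intz.
Qed.

Lemma kronecker_neq0 (p : frieze_poly) (N : nat) :
  p != 0 -> (separator p).[N%:R] != 0 -> frieze_eval (kronecker N) p != 0.
Proof.
move=> p0 sepN.
have inj m m' : m \in msupp p -> m' \in msupp p -> weight N m' = weight N m -> m' = m.
  move=> mp m'p eqw; apply/eqP; apply: contraNT sepN => ne.
  rewrite /separator (big_fsetD1 m) //= hornerM mulf_eq0; apply/orP; left.
  rewrite big_mkcond /= (big_fsetD1 m') //= ne hornerM mulf_eq0; apply/orP; left.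
  by rewrite hornerD hornerN !horner_weight_poly eqw subrr.
have [m mp] : exists m, m \in msupp p.
  by apply/fset0Pn; rewrite msupp_eq0.
apply/eqP => /polyP /(_ (weight N m)).
rewrite frieze_eval_kronecker coef0 coef_sum (big_fsetD1 m) //=.
rewrite coefZ coefXn eqxx mulr1 big1_seq => [|m' /=]; last first.
  rewrite in_fsetD1 => /andP[ne m'p]; rewrite coefZ coefXn.
  case: eqP => [/esym/(inj _ _ mp m'p) e|_]; last by rewrite mulr0.
  by rewrite e eqxx in ne.
by rewrite addr0 => /eqP; apply/negP; rewrite mcoeff_neq0.
Qed.

Lemma exists_nonroot (D : {poly int}) : D != 0 -> exists N : nat, D.[N%:R] != 0.
Proof.
move=> D0; pose s := [seq (i%:R : int) | i <- iota 0 (size D)].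
have [als|/allPn[x /mapP[i _ ->] Di]] := boolP (all (root D) s); last by exists i.
have := max_poly_roots D0 als.
rewrite map_inj_uniq ?iota_uniq; last by move=> i j /eqP; rewrite eqr_nat => /eqP.
by rewrite size_map size_iota ltnn => /(_ isT).
Qed.

Lemma frieze_poly_mulf_eq0 (p q : frieze_poly) : p * q = 0 -> (p == 0) || (q == 0).
Proof.
move=> pq0; apply/norP => -[p0 q0].
have /exists_nonroot[N] : separator p * separator q != 0.
  by rewrite mulf_neq0 ?separator_neq0.
rewrite hornerM mulf_eq0 negb_or => /andP[/(kronecker_neq0 p0) ep /(kronecker_neq0 q0) eq].
have := mulf_neq0 ep eq.
by rewrite -rmorphM pq0 rmorph0 eqxx.
Qed.

Definition frieze_poly_unit : pred frieze_poly := fun p => (p == 1) || (p == -1).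

Lemma frieze_poly_mulVp : {in frieze_poly_unit, left_inverse 1 id *%R}.
Proof.
by move=> p /orP[/eqP ->|/eqP ->]; rewrite ?mulr1 // mulrNN mulr1.
Qed.

Lemma frieze_poly_intro_unit (p q : frieze_poly) : q * p = 1 -> frieze_poly_unit p.
Proof.
move=> qp1; apply/norP; rewrite -subr_eq0 -[p == _]subr_eq0 opprK => -[pN1 pD1].
have /exists_nonroot[N] : separator (p - 1) * separator (p + 1) != 0.
  by rewrite mulf_neq0 ?separator_neq0.
rewrite hornerM mulf_eq0 negb_or => /andP[/(kronecker_neq0 pN1) e1 /(kronecker_neq0 pD1) e2].
move: (e1) (e2); rewrite rmorphB rmorphD rmorph1 /=.
set P := frieze_eval _ p.
have uP : P \is a GRing.unit.
  by apply/unitrPr; exists (frieze_eval (kronecker N) q); rewrite mulrC -rmorphM qp1 rmorph1.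
move: uP; rewrite poly_unitE => /andP[/size_poly1P[c c0 ->]].
rewrite coefC /= -!polyC1 -polyCB -polyCD !polyC_eq0.
by rewrite qualifE /= => /orP[] /eqP ->; rewrite ?subrr ?addNr eqxx.
Qed.

Lemma frieze_poly_inv_out : {in [predC frieze_poly_unit], id =1 id :> (frieze_poly -> _)}.
Proof. by []. Qed.

HB.instance Definition _ := GRing.ComNzRing_hasMulInverse.Build frieze_poly
  frieze_poly_mulVp frieze_poly_intro_unit frieze_poly_inv_out.
HB.instance Definition _ := GRing.ComUnitRing_isIntegral.Build frieze_poly
  frieze_poly_mulf_eq0.

(* The index (p, q) is encoded by the row r = p - q and the integer y = 2 q, so
   that p = y / 2 + r: every pair (r, y) of integers with r >= -3 encodes exactly
   one index, and v r y stands for v_{p, q}.  The four neighbours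
   (p - 1/2, q - 1/2), (p + 1/2, q + 1/2), (p - 1/2, q + 1/2), (p + 1/2, q - 1/2)
   become (r, y - 1), (r, y + 1), (r - 1, y + 1), (r + 1, y - 1). *)
Definition frieze_rule (R : nzRingType) (v : int -> int -> R) : Prop :=
  forall r y : int, -2 <= r ->
    v r y = v r (y - 1) * v r (y + 1) - v (r - 1) (y + 1) * v (r + 1) (y - 1).

(* The bi-infinite sequence c with c_{2 i} = a_i and c_{2 i - 1} = b_i. *)
Definition interleave (T : Type) (a b : int -> T) (y : int) : T :=
  if (2 %| y)%Z then a (y %/ 2)%Z else b ((y + 1) %/ 2)%Z.

Lemma interleave_even (T : Type) (a b : int -> T) i : interleave a b (2 * i) = a i.
Proof. by rewrite /interleave dvdz_mulr // mulKz. Qed.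

Lemma interleave_odd (T : Type) (a b : int -> T) i : interleave a b (2 * i - 1) = b i.
Proof. by rewrite /interleave rpredDl ?dvdz_mulr //= subrK mulKz. Qed.

Definition alg_row0 : int -> frieze_poly :=
  interleave (fun i => fvar (inl i)) (fun i => fvar (inr i)).

(* alg_rows n is the pair of rows n - 1 and n; row n + 1 is solved for in the rule
   at (n, y + 1). *)
Fixpoint alg_rows (n : nat) :
    (int -> {fraction frieze_poly}) * (int -> {fraction frieze_poly}) :=
  if n is n'.+1 then
    let (u, v) := alg_rows n' in
    (v, fun y => (v y * v (y + 2) - v (y + 1)) / u (y + 2))
  else (fun=> 1, fun y => tofrac (alg_row0 y)).

Definition alg_2frieze (r y : int) : {fraction frieze_poly} :=
  if 0 <= r then (alg_rows `|r|%N).2 y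
  else if r == -1 then 1 else 0.

(* The entries in row n - 3 as polynomials in row 0. *)
Fixpoint cont (R : nzRingType) (c : int -> R) (n : nat) (y : int) {struct n} : R :=
  match n with
  | 0 | 1 => 0
  | 2 => 1
  | ((n0.+1 as n1).+1 as n2).+1 =>
      c (y + n0%:Z *+ 2) * cont c n2 y - c (y + n0%:Z *+ 2 - 1) * cont c n1 y
      + cont c n0 y
  end.

Arguments cont : simpl never.

Lemma cont0 (R : nzRingType) (c : int -> R) y : cont c 0%N y = 0. Proof. by []. Qed.
Lemma cont1 (R : nzRingType) (c : int -> R) y : cont c 1%N y = 0. Proof. by []. Qed.
Lemma cont2 (R : nzRingType) (c : int -> R) y : cont c 2%N y = 1. Proof. by []. Qed.
Lemma contSSS (R : nzRingType) (c : int -> R) n y :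
  cont c n.+3 y = c (y + n%:Z *+ 2) * cont c n.+2 y
                  - c (y + n%:Z *+ 2 - 1) * cont c n.+1 y + cont c n y.
Proof. by []. Qed.

Lemma eq_cont (R : nzRingType) (c d : int -> R) n y :
  c =1 d -> cont c n y = cont d n y.
Proof.
move=> cd; suff: [/\ cont c n y = cont d n y, cont c n.+1 y = cont d n.+1 y
  & cont c n.+2 y = cont d n.+2 y] by case.
elim: n => [|n [IH1 IH2 IH3]] //.
by split; [exact: IH2|exact: IH3|rewrite !contSSS !cd IH1 IH2 IH3].
Qed.

Lemma cont_row0 (R : nzRingType) (c : int -> R) y : cont c 3%N y = c y.
Proof. by rewrite contSSS cont0 cont1 cont2 mul0rn mulr0 mulr1 subr0 !addr0. Qed.

Lemma cont_rule (R : comNzRingType) (c : int -> R) n y :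
  cont c n.+1 y = cont c n.+1 (y - 1) * cont c n.+1 (y + 1)
                  - cont c n (y + 1) * cont c n.+2 (y - 1).
Proof.
suff: [/\ cont c n.+1 y = cont c n.+1 (y - 1) * cont c n.+1 (y + 1)
                  - cont c n (y + 1) * cont c n.+2 (y - 1),
         cont c n.+2 y = cont c n.+2 (y - 1) * cont c n.+2 (y + 1)
                  - cont c n.+1 (y + 1) * cont c n.+3 (y - 1)
       & cont c n.+3 y = cont c n.+3 (y - 1) * cont c n.+3 (y + 1)
                  - cont c n.+2 (y + 1) * cont c n.+4 (y - 1)] by case.
elim: n => [|n [IH1 IH2 IH3]].
  have e1 : y + 1 *+ 2 - 1 = y + 1 by ring.
  have e2 : y - 1 + 1 *+ 2 = y + 1 by ring.
  have e3 : y - 1 + 1 *+ 2 - 1 = y by ring.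
  split; rewrite ?contSSS ?cont0 ?cont1 ?cont2 ?mul0rn ?addr0 ?e1 ?e2 ?e3 ?addrK; ring.
split=> //; rewrite (contSSS c n.+1 y) IH1 IH2 IH3.
have e1 : y + n.+1%:Z *+ 2 = y - 1 + n.+2%:Z *+ 2 - 1 by rewrite !intS; ring.
have e2 : y + n.+1%:Z *+ 2 - 1 = y + 1 + n%:Z *+ 2 by rewrite !intS; ring.
have e3 : y + 1 + n%:Z *+ 2 = y - 1 + n.+1%:Z *+ 2 by rewrite !intS; ring.
have e4 : y + 1 + n.+1%:Z *+ 2 = y - 1 + n.+2%:Z *+ 2 by rewrite !intS; ring.
have e5 : y + 1 + n.+1%:Z *+ 2 - 1 = y - 1 + n.+2%:Z *+ 2 - 1 by rewrite !intS; ring.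
have e6 : y + 1 + n%:Z *+ 2 - 1 = y - 1 + n.+1%:Z *+ 2 - 1 by rewrite !intS; ring.
rewrite (contSSS c n.+2 (y - 1)) (contSSS c n.+1 (y - 1)).
rewrite (contSSS c n.+1 (y + 1)) (contSSS c n (y + 1)).
rewrite e2 e1 e5 e4 e6 e3.
move: (cont c n.+1 (y - 1)) (cont c n.+2 (y - 1)) (cont c n.+3 (y - 1)).
move: (cont c n (y + 1)) (cont c n.+1 (y + 1)) (cont c n.+2 (y + 1)).
by move=> *; ring.
Qed.

Lemma frieze_eval_cont (S : comNzRingType) (h : frieze_var -> S) c n y :
  frieze_eval h (cont c n y) = cont (fun i => frieze_eval h (c i)) n y.
Proof.
suff: [/\ frieze_eval h (cont c n y) = cont (fun i => frieze_eval h (c i)) n y,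
   frieze_eval h (cont c n.+1 y) = cont (fun i => frieze_eval h (c i)) n.+1 y
 & frieze_eval h (cont c n.+2 y) = cont (fun i => frieze_eval h (c i)) n.+2 y] by case.
elim: n => [|n [IH1 IH2 IH3]]; first by split; rewrite ?rmorph0 ?rmorph1.
split; [exact: IH2|exact: IH3|].
rewrite (contSSS _ n) [RHS]contSSS -IH1 -IH2 -IH3.
by rewrite rmorphD rmorphB; congr (_ - _ + _); exact: rmorphM.
Qed.

Lemma cont3 (c : int -> int) n y : (forall i, c i = 3) -> cont c n y = 'C(n, 2)%:R.
Proof.
move=> c3; suff: [/\ cont c n y = 'C(n, 2)%:R, cont c n.+1 y = 'C(n.+1, 2)%:R
  & cont c n.+2 y = 'C(n.+2, 2)%:R] by case.
elim: n => [|n [IH1 IH2 IH3]] //.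
split; [exact: IH2|exact: IH3|].
by rewrite contSSS !c3 IH1 IH2 IH3 !binS !bin1 !bin0 !natrD; ring.
Qed.

Lemma cont_alg_neq0 n y : cont alg_row0 n.+2 y != 0.
Proof.
apply/eqP => /(congr1 (frieze_eval (fun=> 3 : int))).
rewrite rmorph0 frieze_eval_cont cont3 => [/eqP|i].
  by rewrite pnatr_eq0 -leqn0 leqNgt bin_gt0.
by rewrite /alg_row0 /interleave; case: ifP => _; rewrite frieze_evalX.
Qed.

Lemma tofrac_solve (D : idomainType) (p q x z w : D) :
  z != 0 -> x = p * q - z * w ->
  (tofrac p * tofrac q - tofrac x) / tofrac z = tofrac w.
Proof.
move=> z0 ->; have tz0 : tofrac z != 0 by rewrite tofrac_eq0.
by rewrite tofracB !tofracM opprB addrCA subrr addr0 mulrAC mulfV ?mul1r.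
Qed.

Lemma alg_rowsE n y :
  (alg_rows n).1 y = tofrac (cont alg_row0 n.+2 y) /\
  (alg_rows n).2 y = tofrac (cont alg_row0 n.+3 y).
Proof.
elim: n y => [|n IHn] y.
  by split; [rewrite [RHS]rmorph1|rewrite cont_row0].
move: IHn; rewrite [alg_rows n.+1]/=; case: (alg_rows n) => u v /= IHn.
split; first by have [] := IHn y.
rewrite [LHS]/= (IHn y).2 (IHn (y + 2)).2 (IHn (y + 1)).2 (IHn (y + 2)).1.
apply: tofrac_solve; first exact: cont_alg_neq0.
by have := cont_rule alg_row0 n.+2 (y + 1); rewrite addrK -addrA.
Qed.

Lemma alg_2friezeE (n : nat) y :
  alg_2frieze (n%:Z - 3) y = tofrac (cont alg_row0 n y).
Proof.
case: n => [|[|[|n]]]; rewrite ?rmorph0 ?rmorph1 //.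
have -> : n.+3%:Z - 3 = n by rewrite !intS; ring.
by rewrite /alg_2frieze /= (alg_rowsE n y).2.
Qed.

Lemma alg_2frieze_out (r y : int) : r < -1 -> alg_2frieze r y = 0.
Proof.
move=> r1; rewrite /alg_2frieze leNgt (lt_trans r1) //=.
by case: eqP r1 => // ->; rewrite ltxx.
Qed.

Lemma alg_2frieze_is_frieze :
  [/\ frieze_rule alg_2frieze,
      forall y, alg_2frieze (-3) y = 0,
      forall y, alg_2frieze (-2) y = 0,
      forall y, alg_2frieze (-1) y = 1
    & forall i : int,
        alg_2frieze 0 (2 * i) = tofrac (fvar (inl i)) /\
        alg_2frieze 0 (2 * i - 1) = tofrac (fvar (inr i))].
Proof.
split=> // [r y r2|i]; last first.
  have row0 y : alg_2frieze 0 y = tofrac (alg_row0 y) by [].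
  by rewrite !row0 /alg_row0 interleave_even interleave_odd.
have [n ->] : exists n : nat, r = n.+1%:Z - 3.
  exists (absz (r + 2)); rewrite intS gez0_abs; first by ring.
  by rewrite -[2]opprK subr_ge0.
have -> : n.+1%:Z - 3 - 1 = n%:Z - 3 by rewrite intS; ring.
have -> : n.+1%:Z - 3 + 1 = n.+2%:Z - 3 by rewrite !intS; ring.
rewrite !alg_2friezeE [in LHS]cont_rule.
by rewrite [LHS]tofracB; congr (_ - _); exact: tofracM.
Qed.

Lemma alg_2frieze_polynomial (r y : int) :
  exists p : frieze_poly, tofrac p == alg_2frieze r y.
Proof.
have [r1|r1] := ltP r (-1).
  by exists 0; rewrite alg_2frieze_out ?rmorph0.
exists (cont alg_row0 (absz (r + 3)) y); rewrite -alg_2friezeE.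
rewrite gez0_abs ?addrK //.
by rewrite -[3]opprK subr_ge0 (le_trans _ r1).
Qed.

(* tofrac being injective, this is the unique polynomial equal to the entry. *)
Definition alg_2frieze_poly (r y : int) : frieze_poly :=
  xchoose (alg_2frieze_polynomial r y).

(* F(a_i, b_i) *)
Definition num_2frieze (R : numFieldType) (a b : int -> R) (r y : int) : R :=
  frieze_eval (fun x => match x with inl i => a i | inr i => b i end)
    (alg_2frieze_poly r y).

Lemma num_2friezeE (R : numFieldType) (a b : int -> R) (n : nat) y :
  num_2frieze a b (n%:Z - 3) y = cont (interleave a b) n y.
Proof.
rewrite /num_2frieze; set h := (fun x => _).
have -> : alg_2frieze_poly (n%:Z - 3) y = cont alg_row0 n y.
  apply/eqP; rewrite -tofrac_eq -alg_2friezeE.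
  exact: (xchooseP (alg_2frieze_polynomial (n%:Z - 3) y)).
rewrite frieze_eval_cont; apply: eq_cont => i.
by rewrite /alg_row0 /interleave; case: ifP => _; rewrite frieze_evalX.
Qed.

(* Closed of width n - 4; intended for n >= 4. *)
Definition closed_2frieze (R : numFieldType) (n : nat) (v : int -> int -> R) : Prop :=
  forall y : int,
    [/\ v (n%:Z - 4) y = 1, v (n%:Z - 3) y = 0 & v (n%:Z - 2) y = 0].

Definition arithmetic_2frieze (R : numFieldType) (n : nat) (v : int -> int -> R) : Prop :=
  closed_2frieze n v /\
  forall r y : int, 0 <= r <= n%:Z - 4 ->
    exists2 m : nat, (0 < m)%N & v r y = m%:R.

(* One period of row 0 of the connected sum, the cut of the first frieze being
   between c_s and c_{s+1}. *)
Definition connected_sum_period (R : numFieldType) (n k : nat) (s : int)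
    (a b a' b' : int -> R) : seq R :=
  let c := interleave a b in
  [:: c (s - 2) + b' 1;
      c (s - 1) + a' 1 + c s * b' 1;
      c s + b' 2]
  ++ flatten [seq [:: a' i%:Z; b' (i%:Z + 1)] | i <- iota 2 (k - 3)%N]
  ++ [:: c (s + 1) + a' (k%:Z - 1);
         c (s + 2) + b' k%:Z + c (s + 1) * a' k%:Z;
         c (s + 3) + a' k%:Z]
  ++ [seq c (s + 4 + i%:Z) | i <- iota 0 (2 * (n - 3))%N].

(* The values b_1, a_1, b_2, a_2, ... are those of the list l, in this order, and
   are extended periodically. *)
Definition periodic_a (R : numFieldType) (l : seq R) (i : int) : R :=
  nth 0 l `|((2 * i - 1) %% (size l)%:Z)%Z|%N.
Definition periodic_b (R : numFieldType) (l : seq R) (i : int) : R :=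
  nth 0 l `|((2 * i - 2) %% (size l)%:Z)%Z|%N.

Definition connected_sum (R : numFieldType) (n k : nat) (s : int)
    (a b a' b' : int -> R) : int -> int -> R :=
  let l := connected_sum_period n k s a b a' b' in
  num_2frieze (periodic_a l) (periodic_b l).

(* Main.v *)
Require Import Defs.
From mathcomp Require Import all_boot all_order all_algebra.
From mathcomp Require Import zify ring.

Set Implicit Arguments.
Unset Strict Implicit.
Unset Printing Implicit Defensive.

Import Order.TTheory GRing.Theory Num.Theory.
Local Open Scope ring_scope.

(** The geometric reason for the theorem is that a closed 2-frieze of period 2n
is the same thing as a closed unimodular n-gon in 3-space.  The entries of a
2-frieze with row 0 [c] are the values [cont c m y], and in [m] they solve the
third order recurrence
  X_(m+3) = c_(t+2m) X_(m+2) - c_(t+2m-1) X_(m+1) + X_m.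
Take a sequence V of vectors solving it, of unit determinant on consecutive
triples.  Then, for either parity of the starting point, every entry is a
determinant [V_i, V_(i+1), V_j] or [V_i, V_j, V_(j+1)]
([cont_bracket_even], [cont_bracket_odd]).  The frieze closes up with period 2n
exactly when the polygon does with period n ([solves_periodic],
[polygon_closing]).

The connected sum glues two polygons.  Normalise by a unimodular map the
polygon Q of the second frieze (k vertices) and the polygon V of the first one
(n vertices) so that
  V_0 = Q_0,  V_2 = Q_(k-1),  V_1 = line(Q_0, Q_1) /\ line(Q_(k-2), Q_(k-1)),
lines being understood projectively; the exact vector is
V_1 = Q_1 - c'_1 Q_0 = Q_(k-2) - c'_(2k) Q_(k-1).  Removing the vertex V_1 and
inserting the remaining vertices of Q between V_0 and V_2 gives the polygon
  W = (Q_0, Q_1, ..., Q_(k-1) = V_2, V_3, ..., V_(n-1))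
with n + k - 3 vertices, and the coefficients of its recurrence are exactly the
row 0 of the connected sum: only the recurrences across the two seams change,
and they change by the six prescribed corrections ([glue_left], [glue_right],
[glue_periodic]).  Choosing the parity of the recurrences so that c_s is the
leading coefficient of its step treats all positions of the cut at once.
Closedness follows.

For positivity, the determinants [W_0, W_1, W_j] and [W_0, W_j, W_(j+1)] of the
fan at W_0 are entries of one of the two given friezes, since W_0, W_1 and V_0,
V_1 span the same flag.  Together with the consecutive determinants they form a
total positivity test: three-term Pluecker relations deduce from them that all
determinants [W_i, W_j, W_l] with i < j < l are positive ([bracket_gt0]), hence
all entries of the connected sum are.  Integrality is clear, the entries being
polynomials with integer coefficients in row 0. *)

(** * Linear recurrences of order three *)

Lemma nat_ind3 (P : nat -> Prop) :
  P 0%N -> P 1%N -> P 2%N ->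
  (forall m, P m -> P m.+1 -> P m.+2 -> P m.+3) -> forall m, P m.
Proof.
move=> P0 P1 P2 PS m; suff: [/\ P m, P m.+1 & P m.+2] by case.
by elim: m => [|m [Pm Pm1 Pm2]]; split=> //; exact: PS.
Qed.

Section Solutions.
Context (R : comNzRingType) (p : nat).
Local Notation E := 'rV[R]_p.
Implicit Types (c : int -> R) (t y : int) (X : nat -> E) (u v w : E).

Definition solves c t X : Prop := forall m,
  X m.+3 = c (t + m%:Z *+ 2) *: X m.+2 - c (t + m%:Z *+ 2 - 1) *: X m.+1 + X m.

Lemma solves_unique c t X Y :
  solves c t X -> solves c t Y ->
  X 0%N = Y 0%N -> X 1%N = Y 1%N -> X 2 = Y 2 -> X =1 Y.
Proof.
move=> sX sY e0 e1 e2; elim/nat_ind3 => // m IH0 IH1 IH2.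
by rewrite sX sY IH0 IH1 IH2.
Qed.

(** The solutions started at [t], [t - 2] and [t - 4], read from their entries
0, 1 and 2 on, have a lower unitriangular matrix of initial values, so that any
initial values are reached by solving a triangular system.  Expressing
solutions through [cont] makes their periodicity a matter of entries. *)
Definition solution c t u v w (m : nat) : E :=
  let v' := v - cont c 3 (t - 4) *: u in
  let w' := w - cont c 4 (t - 4) *: u - cont c 3 (t - 2) *: v' in
  cont c m.+2 (t - 4) *: u + cont c m.+1 (t - 2) *: v' + cont c m t *: w'.

Lemma solution_solves c t u v w : solves c t (solution c t u v w).
Proof.
move=> m; rewrite /solution; set v' := v - _; set w' := w - _ - _.
rewrite (contSSS c m.+2 (t - 4)) (contSSS c m.+1 (t - 2)) (contSSS c m t).
have -> : t - 4 + m.+2%:Z *+ 2 = t + m%:Z *+ 2 by rewrite !intS; ring.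
have -> : t - 2 + m.+1%:Z *+ 2 = t + m%:Z *+ 2 by rewrite !intS; ring.
by apply/rowP => i; rewrite !mxE; ring.
Qed.

Lemma solution0 c t u v w : solution c t u v w 0 = u.
Proof. by rewrite /solution cont0 cont1 cont2 !scale0r scale1r !addr0. Qed.

Lemma solution1 c t u v w : solution c t u v w 1 = v.
Proof. by rewrite /solution cont1 cont2 scale0r scale1r addr0 addrC subrK. Qed.

Lemma solution2 c t u v w : solution c t u v w 2 = w.
Proof. by rewrite /solution cont2; apply/rowP => i; rewrite !mxE; ring. Qed.

Lemma exists_solution c t u v w :
  exists X : nat -> E, [/\ solves c t X, X 0%N = u, X 1%N = v & X 2 = w].
Proof.
exists (solution c t u v w).
by split; [exact: solution_solves|exact: solution0|exact: solution1|exact: solution2].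
Qed.

End Solutions.

(** * Closed friezes have periodic solutions *)

Section Closing.
Context (R : comNzRingType).
Implicit Types (c : int -> R) (t y : int).

(** [cont _ m] being row [m - 3], this is closedness of width [n - 4], stated for
row 0 over any commutative ring. *)
Definition closing c (n : nat) : Prop := forall y,
  [/\ cont c n.-1 y = 1, cont c n y = 0 & cont c n.+1 y = 0].

(** Mirror image of the recurrence defining [cont]: the entries, as functions
of their left end, solve the dual recurrence. *)
Lemma cont_left c m y :
  cont c m.+3 y = c y * cont c m.+2 (y + 2) - c (y + 1) * cont c m.+1 (y + 4)
                  + cont c m (y + 6).
Proof.
elim/nat_ind3: m => [|||m IH0 IH1 IH2].
- by rewrite cont_row0 cont0 cont1 cont2; ring.
- rewrite contSSS !cont_row0 !cont1 !cont2.
  have -> : y + 1%:Z *+ 2 = y + 2 by ring.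
  have -> : y + 2 - 1 = y + 1 by ring.
  by ring.
- rewrite (contSSS c 2 y) (contSSS c 1 y) (contSSS c 1) !cont_row0 !cont1 !cont2.
  have -> : y + 2 + 1%:Z *+ 2 = y + 4 by ring.
  have -> : y + 4 - 1 = y + 3 by ring.
  have -> : y + 2%:Z *+ 2 = y + 4 by ring.
  have -> : y + 1%:Z *+ 2 = y + 2 by ring.
  have -> : y + 2 - 1 = y + 1 by ring.
  by ring.
rewrite contSSS IH0 IH1 IH2.
rewrite (contSSS c m.+2 (y + 2)) (contSSS c m.+1 (y + 4)) (contSSS c m (y + 6)).
have -> : y + m.+3%:Z *+ 2 = y + 6 + m%:Z *+ 2 by rewrite !intS; ring.
have -> : y + 2 + m.+2%:Z *+ 2 = y + 6 + m%:Z *+ 2 by rewrite !intS; ring.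
have -> : y + 4 + m.+1%:Z *+ 2 = y + 6 + m%:Z *+ 2 by rewrite !intS; ring.
by ring.
Qed.

Lemma closing_step c n y : (0 < n)%N -> closing c n -> cont c n.+2 y = 1.
Proof.
case: n => // n _ cl; rewrite contSSS.
by have [/= -> -> ->] := cl y; rewrite !mulr0 subrr add0r.
Qed.

(** Entry [n] of row 0 is computed in two ways: from the left it is [c y], and
from the right it is the last coefficient [c (y + 2 n)]. *)
Lemma closing_periodic c n y :
  (0 < n)%N -> closing c n -> c (y + n%:Z *+ 2) = c y.
Proof.
move=> n0 cl; have := cont_left c n y.
rewrite contSSS !closing_step //.
have [_ -> ->] := cl y; have [_ _ ->] := cl (y + 4); have [_ -> _] := cl (y + 6).
by rewrite !mulr1 !mulr0 !subr0 !addr0.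
Qed.

Lemma closing_cont c n m y :
  (0 < n)%N -> closing c n -> cont c (m + n) y = cont c m y.
Proof.
move=> n0 cl; elim/nat_ind3: m => [|||m IH0 IH1 IH2].
- by have [_ -> _] := cl y.
- by have [_ _ ->] := cl y.
- exact: closing_step.
rewrite -[(m.+3 + n)%N]/((m + n).+3) !contSSS.
have -> : y + (m + n)%N%:Z *+ 2 = y + m%:Z *+ 2 + n%:Z *+ 2 by rewrite PoszD; ring.
have -> : y + m%:Z *+ 2 + n%:Z *+ 2 - 1 = y + m%:Z *+ 2 - 1 + n%:Z *+ 2 by ring.
by rewrite !(closing_periodic _ n0 cl) -IH0 -IH1 -IH2.
Qed.

Lemma solves_periodic p c n t (X : nat -> 'rV[R]_p) : (0 < n)%N -> closing c n ->
  solves c t X -> forall m, X (m + n)%N = X m.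
Proof.
move=> n0 cl sX m.
have e := solves_unique sX (solution_solves c t (X 0%N) (X 1%N) (X 2))
  (esym (solution0 _ _ _ _ _)) (esym (solution1 _ _ _ _ _))
  (esym (solution2 _ _ _ _ _)).
rewrite [LHS]e [RHS]e /solution -!addSn.
by rewrite !(closing_cont _ _ n0 cl).
Qed.

End Closing.

(** * Entries as determinants *)

Section Polygons.
Context (R : comNzRingType).
Implicit Types (c : int -> R) (t y : int) (V : nat -> 'rV[R]_3).

(** The determinant, expanded so that identities between determinants are
polynomial identities in the coordinates. *)
Definition bracket (u v w : 'rV[R]_3) : R :=
  u 0 0 * (v 0 1 * w 0 2 - v 0 2 * w 0 1)
  - u 0 1 * (v 0 0 * w 0 2 - v 0 2 * w 0 0)
  + u 0 2 * (v 0 0 * w 0 1 - v 0 1 * w 0 0).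

Lemma bracket_rot u v w : bracket u v w = bracket v w u.
Proof. by rewrite /bracket; ring. Qed.

Lemma bracket_eql u v : bracket u u v = 0.
Proof. by rewrite /bracket; ring. Qed.

Lemma bracket_eqr u v : bracket u v v = 0.
Proof. by rewrite /bracket; ring. Qed.

Lemma bracket_eqlr u v : bracket u v u = 0.
Proof. by rewrite /bracket; ring. Qed.

Lemma bracket_swap u v w : bracket u w v = - bracket u v w.
Proof. by rewrite /bracket; ring. Qed.

(** Three forms of the three-term Pluecker relation, repeating [o], [w] and [u]
respectively.  Every bracket lists its vectors in the order [o, u, v, w, x] and
every sign is plus, so that positivity propagates. *)
Lemma bracket_plucker o u v w x :
  bracket o u w * bracket o v x =
  bracket o u v * bracket o w x + bracket o u x * bracket o v w.
Proof. by rewrite /bracket; ring. Qed.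

Lemma bracket_plucker_mid o u v w x :
  bracket o v w * bracket u w x =
  bracket o u w * bracket v w x + bracket o w x * bracket u v w.
Proof. by rewrite /bracket; ring. Qed.

Lemma bracket_plucker_left o u v w x :
  bracket o u w * bracket u v x =
  bracket o u v * bracket u w x + bracket o u x * bracket u v w.
Proof. by rewrite /bracket; ring. Qed.

Lemma bracket_linr u v a b x z w :
  bracket u v (a *: x - b *: z + w) =
    a * bracket u v x - b * bracket u v z + bracket u v w.
Proof. by rewrite /bracket !mxE; ring. Qed.

Lemma solves_bracket1 c t V : solves c t V -> bracket (V 0%N) (V 1%N) (V 2) = 1 ->
  forall m, bracket (V m) (V m.+1) (V m.+2) = 1.
Proof.
move=> sV V1; elim=> // m IHm.
by rewrite sV bracket_linr bracket_eqr bracket_eqlr !mulr0 subrr add0r -bracket_rot.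
Qed.

Section Entries.
Context (c : int -> R) (t : int) (V : nat -> 'rV[R]_3).
Context (sV : solves c t V) (V1 : forall m, bracket (V m) (V m.+1) (V m.+2) = 1).

Lemma cont_bracket_even i m :
  cont c m (t + i%:Z *+ 2) = bracket (V i) (V i.+1) (V (i + m)%N).
Proof.
elim/nat_ind3: m => [|||m IH0 IH1 IH2].
- by rewrite addn0 bracket_eqlr.
- by rewrite addn1 bracket_eqr.
- by rewrite addn2 V1.
rewrite contSSS IH0 IH1 IH2 !addnS sV bracket_linr PoszD.
by have -> : t + (i%:Z + m%:Z) *+ 2 = t + i%:Z *+ 2 + m%:Z *+ 2 by ring.
Qed.

(** The other parity corresponds to the dual polygon, whose vertices are the
planes spanned by consecutive vertices. *)
Lemma cont_bracket_odd i m :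
  cont c m.+1 (t + i%:Z *+ 2 - 1) = bracket (V i) (V (i + m)%N) (V (i + m).+1).
Proof.
elim/nat_ind3: m => [|||m IH0 IH1 IH2].
- by rewrite addn0 bracket_eql.
- by rewrite addn1 V1.
- rewrite addn2 cont_row0 sV bracket_linr bracket_eqr bracket_eqlr bracket_swap V1.
  by ring.
rewrite contSSS IH0 IH1 IH2 !addnS.
rewrite [V (i + m).+4]sV bracket_linr bracket_eqr.
rewrite (bracket_swap _ (V (i + m).+2) (V (i + m).+3)).
rewrite (bracket_swap _ (V (i + m).+1) (V (i + m).+3)).
rewrite [in bracket (V i) (V (i + m).+1) (V (i + m).+3)]sV bracket_linr bracket_eqr.
rewrite (bracket_swap _ (V (i + m)%N) (V (i + m).+1)).
have -> : t + (i + m).+1%:Z *+ 2 - 1 = t + i%:Z *+ 2 - 1 + m.+1%:Z *+ 2.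
  by rewrite !intS PoszD; ring.
have -> : t + i%:Z *+ 2 - 1 + m.+1%:Z *+ 2 - 1 = t + (i + m)%N%:Z *+ 2.
  by rewrite !intS PoszD; ring.
by ring.
Qed.

End Entries.
End Polygons.

Section PeriodicEntries.
Context (R : comNzRingType) (d : int -> R) (t : int) (W : nat -> 'rV[R]_3) (N : nat).
Context (N_gt0 : (0 < N)%N) (d_periodic : forall y, d (y + N%:Z *+ 2) = d y).
Context (sW : solves d t W) (W1 : forall m, bracket (W m) (W m.+1) (W m.+2) = 1).

Lemma cont_periodic m y : cont d m (y + N%:Z *+ 2) = cont d m y.
Proof.
elim/nat_ind3: m => // m IH0 IH1 IH2; rewrite !contSSS IH0 IH1 IH2.
have -> : y + N%:Z *+ 2 + m%:Z *+ 2 - 1 = y + m%:Z *+ 2 - 1 + N%:Z *+ 2 by ring.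
have -> : y + N%:Z *+ 2 + m%:Z *+ 2 = y + m%:Z *+ 2 + N%:Z *+ 2 by ring.
by rewrite !d_periodic.
Qed.

(** Every starting point [y] is, up to the period of [d], the starting point of a
vertex of the polygon or of a side of it, according to its parity. *)
Lemma cont_entry y :
  (exists i, forall m, cont d m y = bracket (W i) (W i.+1) (W (i + m)%N)) \/
  (exists i, forall m, cont d m.+1 y = bracket (W i) (W (i + m)%N) (W (i + m).+1)).
Proof.
have shift q m : cont d m (y + (N%:Z *+ 2) *+ q) = cont d m y.
  by elim: q => [|q IHq]; rewrite ?addr0 // mulrSr addrA cont_periodic.
pose q := absz (y - t)%R.
have [x ex] : exists x : nat, y + (N%:Z *+ 2) *+ q = t + x%:Z.
  exists (absz (y - t + (N%:Z *+ 2) *+ q)%R); rewrite gez0_abs; first by ring.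
  have -> : (N%:Z *+ 2) *+ q = (N * 2 * q)%N%:Z by rewrite -mulrnA -mulr_natr; lia.
  by rewrite /q; nia.
have [i [e|e]] : exists i : nat, y + (N%:Z *+ 2) *+ q = t + i%:Z *+ 2
    \/ y + (N%:Z *+ 2) *+ q = t + i%:Z *+ 2 - 1.
- by rewrite ex; exists (x.+1 %/ 2)%N; lia.
- by left; exists i => m; rewrite -(shift q) e (cont_bracket_even sW W1).
- by right; exists i => m; rewrite -(shift q) e (cont_bracket_odd sW W1).
Qed.

Lemma polygon_closing : (2 < N)%N -> (forall m, W (m + N)%N = W m) -> closing d N.
Proof.
move=> N2 WN y; have [] := cont_entry y => -[i ei].
  split; rewrite ei; last 2 first.
  - by rewrite WN bracket_eqlr.
  - by rewrite addnS -addSn WN bracket_eqr.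
  have -> : W i = W (i + N.-1).+1 by rewrite -(WN i); congr W; lia.
  have -> : W i.+1 = W (i + N.-1).+2 by rewrite -(WN i.+1); congr W; lia.
  by rewrite -bracket_rot W1.
have := ei N.-1; rewrite prednK // => eN.
have := ei N.-2; have -> : N.-2.+1 = N.-1 by lia.
move=> eN1; split; rewrite ?eN1 ?eN ?ei.
- have -> : W i = W (i + N.-2).+2 by rewrite -(WN i); congr W; lia.
  by rewrite bracket_rot W1.
- have -> : (i + N.-1).+1 = (i + N)%N by lia.
  by rewrite WN bracket_eqlr.
- by rewrite WN bracket_eql.
Qed.

End PeriodicEntries.

(** * Total positivity from a fan *)

Section Positivity.
Context (F : numDomainType) (W : nat -> 'rV[F]_3) (N : nat).
Context (fan_left : forall j, (1 < j < N)%N -> 0 < bracket (W 0%N) (W 1%N) (W j)).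
Context (fan_next : forall j, (0 < j)%N -> (j.+1 < N)%N ->
  0 < bracket (W 0%N) (W j) (W j.+1)).
Context (consecutive : forall i, (i.+2 < N)%N -> 0 < bracket (W i) (W i.+1) (W i.+2)).

(** Planar case: projecting along [W 0], a sequence of vectors with positive
consecutive determinants, all lying to the left of the first one, turns
monotonically. *)
Lemma fan_gt0 j l : (0 < j < l)%N -> (l < N)%N -> 0 < bracket (W 0%N) (W j) (W l).
Proof.
case: j => // -[/= l1 lN|j /= jl lN]; first by apply: fan_left; rewrite l1.
elim: l jl lN => // l IHl; rewrite ltnS leq_eqVlt => /predU1P[<-|jl] lN.
  exact: fan_next.
have lN' := ltnW lN.
have p0 : 0 < bracket (W 0%N) (W 1%N) (W l) by apply: fan_left; lia.
rewrite -(pmulr_rgt0 _ p0) bracket_plucker.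
apply: addr_gt0; apply: mulr_gt0.
- by apply: fan_left; lia.
- by apply: fan_next; lia.
- by apply: fan_left; lia.
- exact: IHl.
Qed.

(** Induction on the span [l - i].  The determinants [i, l - 1, l] come from the
relation repeating [W (l - 1)], which otherwise involves only shorter spans and
the fan; the remaining ones then follow by lowering [l], with the relation
repeating [W i]. *)
Lemma bracket_gt0 i j l : (i < j < l)%N -> (l < N)%N ->
  0 < bracket (W i) (W j) (W l).
Proof.
have [d] := ubnP (l - i)%N.
elim: d i j l => // d IHd [|i] j l ld /andP[ij jl] lN.
  by apply: fan_gt0; rewrite ?jl ?andbT.
case: l => // l in ld jl lN *.
have last_gt0 : 0 < bracket (W i.+1) (W l) (W l.+1).
  have [il|->] : (i.+2 < l)%N \/ l = i.+2 by lia.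
    rewrite -(pmulr_rgt0 _ (_ : 0 < bracket (W 0%N) (W i.+2) (W l))).
      rewrite bracket_plucker_mid.
      apply: addr_gt0; apply: mulr_gt0.
      - by apply: fan_gt0; lia.
      - by apply: IHd; lia.
      - by apply: fan_gt0; lia.
      - by apply: IHd; lia.
    by apply: fan_gt0; lia.
  by apply: consecutive; lia.
move: jl; rewrite ltnS leq_eqVlt => /predU1P[->//|jl].
rewrite -(pmulr_rgt0 _ (_ : 0 < bracket (W 0%N) (W i.+1) (W l))).
  rewrite bracket_plucker_left.
  apply: addr_gt0; apply: mulr_gt0 => //.
  - by apply: fan_gt0; lia.
  - by apply: fan_gt0; lia.
  - by apply: IHd; lia.
by apply: fan_gt0; lia.
Qed.

Context (W_periodic : forall m, W (m + N)%N = W m).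

Lemma W_periodicM q m : W (m + q * N)%N = W m.
Proof. by elim: q => [|q IHq]; rewrite ?addn0 // mulSnr addnA W_periodic. Qed.

Lemma bracket_cyclic_gt0 i j l : (i < j < l)%N -> (l < i + N)%N ->
  0 < bracket (W i) (W j) (W l).
Proof.
have shift x : (i %/ N * N <= x)%N -> W x = W (x - i %/ N * N)%N.
  by move=> le; rewrite -{1}(subnK le) W_periodicM.
move=> /andP[ij jl] lN.
have iN : (i %/ N * N <= i)%N by exact: leq_divM.
rewrite (shift i) // (shift j) ?(shift l); [|lia..].
have {shift}: (i - i %/ N * N < N)%N.
  by rewrite {1}(divn_eq i N) addKn ltn_mod; lia.
set p := (i %/ N * N)%N in iN *.
have : (i - p < j - p < l - p)%N by lia.
have : (l - p < i - p + N)%N by lia.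
move: (i - p)%N (j - p)%N (l - p)%N => u v w wN /andP[uv vw] uN.
have unshift x : (N <= x)%N -> W x = W (x - N)%N.
  by move=> le; rewrite -{1}(subnK le) W_periodic.
case: (ltnP w N) => [wN'|Nw]; first by apply: bracket_gt0; lia.
rewrite (unshift w) //; case: (ltnP v N) => [vN|Nv].
  by rewrite -bracket_rot; apply: bracket_gt0; lia.
by rewrite (unshift v) // bracket_rot; apply: bracket_gt0; lia.
Qed.

End Positivity.

(** * Gluing polygons *)

Section Gluing.
Context (R : comNzRingType).

(** Row 0 of the connected sum of [c], cut after [c s], and [c'], as a function on
the integers: the recurrences of the glued polygon are read off from these
values, without the bookkeeping of positions in a list. *)
Record glued_rows (n k : nat) (c c' : int -> R) (s : int) (d : int -> R) : Prop :=
  GluedRows {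
    glued_left1 : d 1 = c (s - 2) + c' 1;
    glued_left2 : d 2 = c (s - 1) + c' 2 + c s * c' 1;
    glued_left3 : d 3 = c s + c' 3;
    glued_block : forall j : nat, (4 <= j <= 2 * k - 3)%N -> d j = c' j;
    glued_right1 : d (2 * k - 2)%N = c (s + 1) + c' (2 * k - 2)%N;
    glued_right2 : d (2 * k - 1)%N =
      c (s + 2) + c' (2 * k - 1)%N + c (s + 1) * c' (2 * k)%N;
    glued_right3 : d (2 * k)%N = c (s + 3) + c' (2 * k)%N;
    glued_tail : forall j : nat, (1 <= j <= 2 * (n - 3))%N ->
      d (2 * k + j)%N = c (s + 3 + j%:Z);
    glued_periodic : forall y, d (y + (n + k - 3)%N%:Z *+ 2) = d y
  }.

Context (n k : nat) (hn : (4 <= n)%N) (hk : (4 <= k)%N).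
Context (c c' d : int -> R) (s : int).
Let N := (n + k - 3)%N.
Context (cn : closing c n) (ck : closing c' k) (dG : glued_rows n k c c' s d).
Context (Q V W : nat -> 'rV[R]_3).
(* The offsets 5 and s + 2 pair the coefficients so that both seams fall between
   two steps of the recurrences. *)
Context (sQ : solves c' 5 Q) (sV : solves c (s + 2) V) (sW : solves d 5 W).
Context (V0 : V 0%N = Q 0%N) (V1 : V 1%N = Q 1%N - c' 1 *: Q 0%N) (V2 : V 2 = Q k.-1).
Context (W0 : W 0%N = Q 0%N) (W1 : W 1%N = Q 1%N) (W2 : W 2 = Q 2).

Let n0 : (0 < n)%N. Proof. exact: leq_trans hn. Qed.
Let k0 : (0 < k)%N. Proof. exact: leq_trans hk. Qed.

Lemma glue_left i : (i < k)%N -> W i = Q i.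
Proof.
elim/nat_ind3: i => // m IH0 IH1 IH2 mk.
rewrite sW sQ IH0 ?IH1 ?IH2; [|lia..].
have -> : 5 + m%:Z *+ 2 - 1 = (2 * m + 4)%N%:Z by lia.
have -> : 5 + m%:Z *+ 2 = (2 * m + 5)%N%:Z by lia.
by rewrite !(glued_block dG) //; lia.
Qed.

(** Only the steps producing [V 3] and [V 4] meet the right seam.  The point is
that [V 1] is also [Q (k - 2) - c'_(2k) Q (k - 1)], by the recurrence of [Q] once
around. *)
Lemma glue_right j : (j <= n - 2)%N -> W (k.-1 + j)%N = V j.+2.
Proof.
have Qk : Q k = Q 0%N by rewrite -[RHS](solves_periodic k0 ck sQ).
have Qk1 : Q k.+1 = Q 1%N by rewrite -[RHS](solves_periodic k0 ck sQ).
have c'1 : c' (2 * k + 1)%N = c' 1.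
  by rewrite -[RHS](closing_periodic _ k0 ck); congr c'; lia.
have V1' : V 1%N = Q k.-2 - c' (2 * k)%N *: Q k.-1.
  rewrite V1 -Qk1 -Qk -c'1; have := sQ k.-2; rewrite !prednK; [|lia..] => ->.
  have -> : 5 + k.-2%:Z *+ 2 - 1 = (2 * k)%N%:Z by lia.
  have -> : 5 + k.-2%:Z *+ 2 = (2 * k + 1)%N%:Z by lia.
  by apply/rowP => i; rewrite !mxE; ring.
have V3 : W k = V 3.
  rewrite sV V0 -Qk V1' V2.
  have [k' ek] : exists k', k = k'.+3 by exists (k - 3)%N; lia.
  have := sW k'; have := sQ k'; rewrite -ek => -> ->.
  rewrite !glue_left; [|lia..].
  have -> : 5 + k'%:Z *+ 2 - 1 = (2 * k - 2)%N%:Z by lia.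
  have -> : 5 + k'%:Z *+ 2 = (2 * k - 1)%N%:Z by lia.
  have -> : s + 2 + 0%:Z *+ 2 - 1 = s + 1 by ring.
  have -> : s + 2 + 0%:Z *+ 2 = s + 2 by ring.
  have -> : k.-2 = k'.+1 by lia.
  have -> : k.-1 = k'.+2 by lia.
  by rewrite (glued_right1 dG) (glued_right2 dG); apply/rowP => i; rewrite !mxE; ring.
elim/nat_ind3: j => [|||m IH0 IH1 IH2] jn.
- by rewrite addn0 glue_left // prednK.
- by rewrite addn1 prednK.
- have [k' ek] : exists k', k = k'.+2 by exists (k - 2)%N; lia.
  have -> : (k.-1 + 2)%N = k'.+3 by lia.
  rewrite sW -ek V3 !glue_left; [|lia..].
  rewrite [V 4]sV V1' V2.
  have -> : 5 + k'%:Z *+ 2 - 1 = (2 * k)%N%:Z by lia.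
  have -> : 5 + k'%:Z *+ 2 = (2 * k + 1)%N%:Z by lia.
  rewrite (glued_right3 dG) (glued_tail dG); last by lia.
  have -> : s + 2 + 1%:Z *+ 2 - 1 = s + 3 by ring.
  have -> : s + 2 + 1%:Z *+ 2 = s + 3 + 1%:Z by ring.
  have -> : k.-2 = k' by lia.
  have -> : k.-1 = k'.+1 by lia.
  by apply/rowP => i; rewrite !mxE; ring.
rewrite !addnS sW -!addnS IH0 ?IH1 ?IH2; [|lia..].
rewrite [RHS]sV.
have -> : 5 + (k.-1 + m)%N%:Z *+ 2 - 1 = (2 * k + (2 * m + 2))%N%:Z by lia.
have -> : 5 + (k.-1 + m)%N%:Z *+ 2 = (2 * k + (2 * m + 3))%N%:Z by lia.
rewrite !(glued_tail dG); [|lia..].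
by congr (c _ *: _ - c _ *: _ + _); lia.
Qed.

(** The left seam is met after one turn, where the recurrence of [W] must lead
back from [V (n - 2)], [V (n - 1)], [V n = Q 0] to [Q 1] and [Q 2]. *)
Lemma glue_periodic m : W (m + N)%N = W m.
Proof.
have eN i : (i <= n - 2)%N -> W (N - i)%N = V (n - i)%N.
  move=> i_n; have -> : (N - i = k.-1 + (n - 2 - i))%N by rewrite /N; lia.
  by rewrite glue_right; [congr V; lia|lia].
have Vn := solves_periodic n0 cn sV.
have Qk := solves_periodic k0 ck sQ.
have WN : W N = W 0%N.
  by have := eN 0%N isT; rewrite !subn0 => ->; rewrite W0 -V0 -[RHS]Vn.
have cs (x y : int) : x = y + n%:Z *+ 2 -> c x = c y.
  by move=> ->; exact: closing_periodic.
have WN1 : W N.+1 = W 1%N.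
  have -> : N.+1 = (N - 2).+3 by rewrite /N; lia.
  have -> : W 1%N = V n.+1 + c' 1 *: V n.
    by rewrite W1 (Vn 0%N) (Vn 1%N) V0 V1 subrK.
  have -> : V n.+1 = V (n - 2).+3 by congr V; lia.
  have e1 : (N - 2).+1 = (N - 1)%N by rewrite /N; lia.
  have e2 : (N - 2).+2 = (N - 0)%N by rewrite /N; lia.
  rewrite sW sV e2 e1 !eN; [|lia..].
  have -> : (n - 2).+2 = n by lia.
  have -> : (n - 2).+1 = (n - 1)%N by lia.
  have -> : 5 + (N - 2)%N%:Z *+ 2 - 1 = (2 * k + 2 * (n - 3))%N%:Z by rewrite /N; lia.
  rewrite (glued_tail dG); last by lia.
  have -> : 5 + (N - 2)%N%:Z *+ 2 = 1 + N%:Z *+ 2 by rewrite /N; lia.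
  rewrite (glued_periodic dG) (glued_left1 dG) subn0.
  rewrite (cs (s + 2 + _) (s - 2)); last by lia.
  rewrite (cs (s + 3 + _) (s - 3)); last by lia.
  rewrite (cs (s + 2 + _ - 1) (s - 3)); last by lia.
  by apply/rowP => i; rewrite !mxE; ring.
have WN2 : W N.+2 = W 2.
  have Q2 : Q 2 = c' 3 *: Q 1%N - c' 2 *: Q 0%N + V 2.
    rewrite V2 -[LHS]Qk -(Qk 1%N) -(Qk 0%N).
    have [k' ek] : exists k', k = k'.+1 by exists k.-1; lia.
    rewrite ek !addSn add0n sQ /=; congr (_ *: _ - _ *: _ + _).
    - by rewrite -[RHS](closing_periodic _ k0 ck); congr c'; lia.
    - by rewrite -[RHS](closing_periodic _ k0 ck); congr c'; lia.
  have -> : N.+2 = (N - 1).+3 by rewrite /N; lia.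
  have e1 : (N - 1).+1 = N by rewrite /N; lia.
  rewrite sW e1 WN1 WN W2 W1 W0 Q2 eN; last by lia.
  have e2 : (2 + n)%N = (n - 1).+3 by lia.
  rewrite -[V 2]Vn e2 sV.
  have -> : (n - 1).+2 = (1 + n)%N by lia.
  have -> : (n - 1).+1 = (0 + n)%N by lia.
  rewrite !Vn V0 V1.
  have -> : 5 + (N - 1)%N%:Z *+ 2 - 1 = 2 + N%:Z *+ 2 by rewrite /N; lia.
  have -> : 5 + (N - 1)%N%:Z *+ 2 = 3 + N%:Z *+ 2 by rewrite /N; lia.
  rewrite !(glued_periodic dG) (glued_left2 dG) (glued_left3 dG).
  rewrite (cs (s + 2 + _) s); last by lia.
  rewrite (cs (s + 2 + _ - 1) (s - 1)); last by lia.
  by apply/rowP => i; rewrite !mxE; ring.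
suff e : (fun m => W (m + N)%N) =1 W by exact: e.
apply: solves_unique sW _ _ _ => // i.
rewrite !addSn sW PoszD.
have -> : 5 + (i%:Z + N%:Z) *+ 2 - 1 = 5 + i%:Z *+ 2 - 1 + N%:Z *+ 2 by ring.
have -> : 5 + (i%:Z + N%:Z) *+ 2 = 5 + i%:Z *+ 2 + N%:Z *+ 2 by ring.
by rewrite !(glued_periodic dG).
Qed.

End Gluing.

(** Unimodular polygons with coefficients [c], from the offset [t] on. *)
Definition polygon (R : comNzRingType) (c : int -> R) (t : int) (V : nat -> 'rV[R]_3) :=
  solves c t V /\ forall m, bracket (V m) (V m.+1) (V m.+2) = 1.

(** The standard basis starts [Q]; then [V 0], [V 1], [V 2] are the vectors
imposed by the gluing, and they have determinant 1 because [Q (k - 1)], [Q 0],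
[Q 1] are consecutive on the closed polygon [Q]. *)
Lemma glued_polygons (R : comNzRingType) (n k : nat) (c c' d : int -> R) (s : int) :
  (4 <= n)%N -> (4 <= k)%N -> closing c n -> closing c' k ->
  glued_rows n k c c' s d ->
  exists Q V W : nat -> 'rV[R]_3,
    [/\ [/\ polygon c' 5 Q, polygon c (s + 2) V, polygon d 5 W
          & forall m, W (m + (n + k - 3))%N = W m],
        forall i, (i < k)%N -> W i = Q i,
        forall j, (j <= n - 2)%N -> W (k.-1 + j)%N = V j.+2,
        V 0%N = W 0%N
      & forall x, bracket (V 0%N) (V 1%N) x = bracket (W 0%N) (W 1%N) x].
Proof.
move=> hn hk cn ck dG.
have [Q [sQ Q0 Q1 Q2]] := exists_solution c' 5
  (delta_mx 0 0) (delta_mx 0 1) (delta_mx 0 2 : 'rV[R]_3).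
have [V [sV V0 V1 V2]] := exists_solution c (s + 2)
  (Q 0%N) (Q 1%N - c' 1 *: Q 0%N) (Q k.-1).
have [W [sW W0 W1 W2]] := exists_solution d 5 (Q 0%N) (Q 1%N) (Q 2).
have Q_bracket : forall m, bracket (Q m) (Q m.+1) (Q m.+2) = 1.
  apply: (solves_bracket1 sQ); rewrite Q0 Q1 Q2.
  by rewrite /bracket !mxE /=; ring.
have V_bracket01 x : bracket (V 0%N) (V 1%N) x = bracket (Q 0%N) (Q 1%N) x.
  by rewrite V0 V1; rewrite /bracket !mxE; ring.
exists Q, V, W; split.
- split; [by split|split=> //|split=> //|].
  + apply: (solves_bracket1 sV); rewrite V_bracket01 V2 -bracket_rot.
    have k0 : (0 < k)%N by exact: leq_trans hk.
    have Qk := solves_periodic k0 ck sQ.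
    have <- : Q k.-1.+1 = Q 0%N by rewrite -[RHS]Qk prednK.
    have <- : Q k.-1.+2 = Q 1%N by rewrite -[RHS]Qk prednK.
    exact: Q_bracket.
  + by apply: (solves_bracket1 sW); rewrite W0 W1 W2 Q_bracket.
  + exact: (glue_periodic hn hk cn ck dG sQ sV sW).
- exact: (glue_left hn hk dG sQ sW).
- exact: (glue_right hn hk ck dG sQ sV sW).
- by rewrite V0 W0.
- by move=> x; rewrite V_bracket01 W0 W1.
Qed.

(** * Closedness and positivity of the glued frieze *)

Lemma glued_closing (R : comNzRingType) (n k : nat) (c c' d : int -> R) (s : int) :
  (4 <= n)%N -> (4 <= k)%N -> closing c n -> closing c' k ->
  glued_rows n k c c' s d -> closing d (n + k - 3).
Proof.
move=> hn hk cn ck dG.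
have [Q [V [W [[_ _ [sW W_bracket] WN] _ _ _ _]]]] := glued_polygons hn hk cn ck dG.
by apply: (polygon_closing _ (glued_periodic dG) sW W_bracket _ WN); lia.
Qed.

(** Rows 0 to [n - 4], [cont _ m] being row [m - 3]. *)
Definition positive_rows (R : numDomainType) (n : nat) (c : int -> R) : Prop :=
  forall m y, (2 < m < n)%N -> 0 < cont c m y.

Lemma fan_positive (R : numDomainType) (n : nat) (c : int -> R) t (V : nat -> 'rV[R]_3) :
  polygon c t V -> positive_rows n c ->
  (forall j, (1 < j < n)%N -> 0 < bracket (V 0%N) (V 1%N) (V j)) /\
  (forall j, (0 < j)%N -> (j.+1 < n)%N -> 0 < bracket (V 0%N) (V j) (V j.+1)).
Proof.
move=> [sV V_bracket] pc.
have row_gt0 m y : (1 < m < n)%N -> 0 < cont c m y.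
  case: m => [|[|[|m]]] // mn; exact: pc.
split=> j.
  by move=> ?; rewrite -(cont_bracket_even sV V_bracket 0 j); exact: row_gt0.
by move=> ? ?; rewrite -(cont_bracket_odd sV V_bracket 0 j); apply: row_gt0; lia.
Qed.

(** The fan of [W] at [W 0] consists of the fan of [Q] at [Q 0] followed by the
fan of [V] at [V 0], because replacing [W 1 = Q 1] by [V 1] does not change the
determinants with [W 0] and a third vector. *)
Lemma glued_positive (R : numDomainType) (n k : nat) (c c' d : int -> R) (s : int) :
  (4 <= n)%N -> (4 <= k)%N -> closing c n -> closing c' k ->
  glued_rows n k c c' s d ->
  positive_rows n c -> positive_rows k c' -> positive_rows (n + k - 3) d.
Proof.
move=> hn hk cn ck dG pc pc'.
have [Q [V [W [[pQ pV [sW W_bracket] WN] WQ WV V0 V01]]]] := glued_polygons hn hk cn ck dG.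
set N := (n + k - 3)%N in WN *.
have [Q01 Q0j] := fan_positive pQ pc'; have [V01j V0j] := fan_positive pV pc.
have split_index j : (k <= j.+1)%N -> (j <= N)%N ->
    exists2 i, W j = V i.+2 & (j = k.-1 + i)%N.
  move=> kj jN; exists (j - k.-1)%N; last by lia.
  by rewrite -WV; [congr W; lia|rewrite /N in jN; lia].
have fan1 j : (1 < j < N)%N -> 0 < bracket (W 0%N) (W 1%N) (W j).
  move=> jN; case: (ltnP j k) => jk.
    by rewrite !WQ; [apply: Q01|..]; lia.
  have [||i -> ij] := split_index j; [lia..|].
  by rewrite -V01; apply: V01j; rewrite /N in jN; lia.
have fan2 j : (0 < j)%N -> (j.+1 < N)%N -> 0 < bracket (W 0%N) (W j) (W j.+1).
  move=> j0 jN; case: (ltnP j.+1 k) => jk.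
    by rewrite !WQ; [apply: Q0j|..]; lia.
  have [||i -> ij] := split_index j; [lia..|].
  have -> : W j.+1 = V i.+3 by rewrite -WV; [congr W; lia|rewrite /N in jN; lia].
  by rewrite -V0; apply: V0j; rewrite /N in jN; lia.
have consecutive i : (i.+2 < N)%N -> 0 < bracket (W i) (W i.+1) (W i.+2).
  by rewrite W_bracket ltr01.
have pW := bracket_cyclic_gt0 fan1 fan2 consecutive WN.
move=> m y /andP[m2 mN].
have N0 : (0 < N)%N by rewrite /N; lia.
have [[i ->]|[i]] := cont_entry N0 (glued_periodic dG) sW W_bracket y.
  by apply: pW; lia.
case: m m2 mN => [//|m] m2 mN ->; apply: pW; lia.
Qed.

(** * Row 0 of the connected sum *)

Lemma interleave_periodic (R : numFieldType) (l : seq R) y :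
  interleave (periodic_a l) (periodic_b l) y =
  nth 0 l `|((y - 1) %% (size l)%:Z)%Z|%N.
Proof.
have [i [->|->]] : exists i, y = 2 * i \/ y = 2 * i - 1 by exists ((y + 1) %/ 2)%Z; lia.
  by rewrite interleave_even.
by rewrite interleave_odd /periodic_b; congr (nth 0 l `|(_ %% _)%Z|%N); ring.
Qed.

Lemma flatten_interleave (T : Type) (a b : int -> T) p q :
  flatten [seq [:: a i%:Z; b (i%:Z + 1)] | i <- iota p q] =
  [seq interleave a b j%:Z | j <- iota (2 * p) (2 * q)].
Proof.
elim: q p => [|q IHq] p //.
rewrite mulnS /= IHq mulnS; congr [:: _, _ & _].
  by rewrite -(interleave_even a b) PoszM.
by rewrite -(interleave_odd a b); congr interleave; lia.
Qed.

Section Integral.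
Context (R : numFieldType).

Definition integral (x : R) : Prop := exists z : int, x = z%:~R.

Lemma integral0 : integral 0. Proof. by exists 0. Qed.
Lemma integral1 : integral 1. Proof. by exists 1. Qed.

Lemma integralD (x y : R) : integral x -> integral y -> integral (x + y).
Proof. by move=> [u ->] [v ->]; exists (u + v); rewrite rmorphD. Qed.

Lemma integralB (x y : R) : integral x -> integral y -> integral (x - y).
Proof. by move=> [u ->] [v ->]; exists (u - v); rewrite rmorphB. Qed.

Lemma integralM (x y : R) : integral x -> integral y -> integral (x * y).
Proof. by move=> [u ->] [v ->]; exists (u * v); rewrite rmorphM. Qed.

Lemma integral_nth (T : Type) (f : T -> R) (r : seq T) i :
  (forall t, integral (f t)) -> integral (nth 0 [seq f t | t <- r] i).
Proof.
move=> fz; elim: r i => [|t r IHr] [|i] //=; exact: integral0.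
Qed.

Lemma integral_cont (c : int -> R) : (forall y, integral (c y)) ->
  forall m y, integral (cont c m y).
Proof.
move=> cz m y; elim/nat_ind3: m => [|||m IH0 IH1 IH2].
- exact: integral0.
- exact: integral0.
- exact: integral1.
by rewrite contSSS; apply: integralD => //; apply: integralB; apply: integralM.
Qed.

End Integral.

Section Row0.
Context (R : numFieldType) (n k : nat) (s : int) (a b a' b' : int -> R).
Context (hn : (4 <= n)%N) (hk : (4 <= k)%N).
Let c := interleave a b.
Let c' := interleave a' b'.
Let l := connected_sum_period n k s a b a' b'.
Let d := interleave (periodic_a l) (periodic_b l).

Lemma size_connected_sum_period : size l = ((n + k - 3) * 2)%N.
Proof.
rewrite /l /connected_sum_period flatten_interleave !size_cat /= !size_map !size_iota.
by lia.
Qed.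

Lemma connected_sum_row_nth j : (j < (n + k - 3) * 2)%N -> d j.+1%:Z = nth 0 l j.
Proof.
move=> jN; rewrite /d interleave_periodic size_connected_sum_period.
have -> : j.+1%:Z - 1 = j%:Z by lia.
by rewrite modz_nat modn_small.
Qed.

Lemma connected_sum_period_nth j :
  nth 0 l j = if (j < 3)%N then
   nth 0 [:: c (s - 2) + b' 1; c (s - 1) + a' 1 + c s * b' 1; c s + b' 2] j
   else if (j - 3 < 2 * (k - 3))%N then
    nth 0 [seq c' j%:Z | j <- iota 4 (2 * (k - 3))] (j - 3)
   else if (j - 3 - 2 * (k - 3) < 3)%N then
    nth 0 [:: c (s + 1) + a' (k%:Z - 1);
         c (s + 2) + b' k%:Z + c (s + 1) * a' k%:Z;
         c (s + 3) + a' k%:Z] (j - 3 - 2 * (k - 3))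
   else nth 0 [seq c (s + 4 + i%:Z) | i <- iota 0 (2 * (n - 3))%N]
     (j - 3 - 2 * (k - 3) - 3).
Proof.
by rewrite /l /connected_sum_period flatten_interleave !nth_cat /= !size_map !size_iota.
Qed.

Lemma connected_sum_glued : glued_rows n k c c' s d.
Proof.
have dE := connected_sum_row_nth.
have nthE := connected_sum_period_nth.
have c'0 : c' (2 * k - 2)%N = a' (k%:Z - 1)
  by rewrite -(interleave_even a' b'); congr interleave; lia.
have c'1 : c' (2 * k - 1)%N = b' k%:Z
  by rewrite -(interleave_odd a' b'); congr interleave; lia.
have c'2 : c' (2 * k)%N = a' k%:Z
  by rewrite -(interleave_even a' b'); congr interleave; lia.
split.
- by rewrite (dE 0%N) ?nthE //; lia.
- by rewrite (dE 1%N) ?nthE //; lia.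
- by rewrite (dE 2%N) ?nthE //; lia.
- case=> // j jk; rewrite dE; last by lia.
  rewrite nthE ifF ?ifT; [|lia..].
  by rewrite (nth_map 0%N) ?size_iota ?nth_iota; [congr (c' _)|..]; lia.
- have -> : (2 * k - 2)%N = (2 * k - 3).+1 by lia.
  rewrite dE ?nthE 2?ifF ?ifT; [|lia..].
  have -> : (2 * k - 3 - 3 - 2 * (k - 3) = 0)%N by lia.
  have -> : (2 * k - 3).+1 = (2 * k - 2)%N by lia.
  by rewrite c'0.
- have -> : (2 * k - 1)%N = (2 * k - 2).+1 by lia.
  rewrite dE ?nthE 2?ifF ?ifT; [|lia..].
  have -> : (2 * k - 2 - 3 - 2 * (k - 3) = 1)%N by lia.
  have -> : (2 * k - 2).+1 = (2 * k - 1)%N by lia.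
  by rewrite c'1 c'2.
- have -> : (2 * k)%N = (2 * k - 1).+1 by lia.
  rewrite dE ?nthE 2?ifF ?ifT; [|lia..].
  have -> : (2 * k - 1 - 3 - 2 * (k - 3) = 2)%N by lia.
  have -> : (2 * k - 1).+1 = (2 * k)%N by lia.
  by rewrite c'2.
- case=> // j jn; rewrite addnS dE; last by lia.
  rewrite nthE !ifF; [|lia..].
  rewrite (nth_map 0%N) ?size_iota ?nth_iota; [congr (c _)|..]; lia.
- move=> y; rewrite /d !interleave_periodic size_connected_sum_period.
  congr (nth 0 l `|_|%N).
  have -> : y + (n + k - 3)%N%:Z *+ 2 - 1 = y - 1 + ((n + k - 3) * 2)%N%:Z by lia.
  by rewrite modzDr.
Qed.

Lemma connected_sum_integral : (forall y, integral (c y)) ->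
  (forall y, integral (c' y)) -> forall y, integral (d y).
Proof.
move=> cz cz' y; rewrite /d interleave_periodic.
have az i : integral (a' i) by rewrite -(interleave_even a' b').
have bz i : integral (b' i) by rewrite -(interleave_odd a' b').
move: (absz _) => j; rewrite connected_sum_period_nth.
case: ifP => [|_].
  by case: j => [|[|[|j]]] //= _; do ?[apply: integralD | apply: integralM].
case: ifP => [_|_]; first exact: integral_nth.
case: ifP => [|_]; last exact: integral_nth.
by case: (_ - _)%N => [|[|[|i]]] //= _; do ?[apply: integralD | apply: integralM].
Qed.

End Row0.

(** * The connected sum of friezes *)

Section Friezes.
Context (R : numFieldType).

Lemma num_2frieze_row (a b : int -> R) r y : -3 <= r ->
  num_2frieze a b r y = cont (interleave a b) `|(r + 3)%R|%N y.
Proof.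
move=> r3; have e : r = `|(r + 3)%R|%N%:Z - 3 by lia.
by rewrite [in LHS]e num_2friezeE.
Qed.

Lemma closed_2friezeE (a b : int -> R) n : (0 < n)%N ->
  closed_2frieze n (num_2frieze a b) <-> closing (interleave a b) n.
Proof.
move=> n0.
have e1 : (n%:Z - 4) = n.-1%:Z - 3 by lia.
have e2 : (n%:Z - 2) = n.+1%:Z - 3 by lia.
by split=> cl y; have := cl y; rewrite e1 e2 !num_2friezeE.
Qed.

(** Integrality needs to be checked in row 0 only, the other entries being
integer polynomials in row 0. *)
Lemma arithmetic_2friezeE (a b : int -> R) n : (4 <= n)%N ->
  arithmetic_2frieze n (num_2frieze a b) <->
  [/\ closing (interleave a b) n,
      forall y, integral (interleave a b y)
    & positive_rows n (interleave a b)].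
Proof.
move=> n4; have n0 : (0 < n)%N by exact: leq_trans n4.
split=> [[cl ar]|[cl cz pc]].
  split; first exact/closed_2friezeE.
    move=> y; have [|m _ e] := ar 0 y; first by lia.
    by exists m%:Z; rewrite -cont_row0 -num_2friezeE.
  move=> m y mn; have [|p p0 e] := ar (m%:Z - 3) y; first by lia.
  by rewrite -num_2friezeE e ltr0n.
split; first exact/closed_2friezeE.
move=> r y rn; rewrite num_2frieze_row; last by lia.
have [z ez] := integral_cont cz `|(r + 3)%R|%N y.
have : 0 < cont (interleave a b) `|(r + 3)%R|%N y by apply: pc; lia.
rewrite ez ltr0z => z0; exists `|z|%N; first by lia.
by rewrite -[in LHS](gtz0_abs z0).
Qed.

End Friezes.

Theorem theorem3 (R : numFieldType) (n k : nat) (a b a' b' : int -> R) (s : int)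
    (hn : (4 <= n)%N) (hk : (4 <= k)%N)
    (hF : closed_2frieze n (num_2frieze a b))
    (hF' : closed_2frieze k (num_2frieze a' b')) :
  closed_2frieze (n + k - 3)%N (connected_sum n k s a b a' b') /\
  (arithmetic_2frieze n (num_2frieze a b) ->
   arithmetic_2frieze k (num_2frieze a' b') ->
   arithmetic_2frieze (n + k - 3)%N (connected_sum n k s a b a' b')).
Proof.
have dG := connected_sum_glued s a b a' b' hn hk.
have cn : closing (interleave a b) n by apply/closed_2friezeE; [lia|].
have ck : closing (interleave a' b') k by apply/closed_2friezeE; [lia|].
have cN := glued_closing hn hk cn ck dG.
split; first by apply/closed_2friezeE; [lia|].
move=> /(arithmetic_2friezeE _ _ hn)[_ cz pc] /(arithmetic_2friezeE _ _ hk)[_ cz' pc'].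
apply/arithmetic_2friezeE; first by lia.
split=> //; first exact: connected_sum_integral.
exact: glued_positive dG pc pc'.
Qed.
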